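(* Let $n \ge 1$. The relation $\rightharpoonup$ on $X_n$ is the covering relation of a partial order $\leq$ on $X_n$. Moreover, there is a poset isomorphism $A : (X_n,\leq) \to \mathcal{I}_{C_n}$ such that, for all $w \in X_n$, the alcove $A(w)$ is contained in the hypersimplex $\Delta_{C_n,\operatorname{cdes}(w^{-1})}$.
   Context: Signed permutations: $\mathfrak{B}_n$ is the group of bijections $w$ of $[\![n]\!] := \{-n,\dots,-1,1,\dots,n\}$ with $w(-i)=-w(i)$; $\bar i := -i$, $w_i := w(i)$, window notation $w = w_1\cdots w_n$. $X_n := \{w \in \mathfrak{B}_n \mid w^{-1}(1) > 0\}$. Order $[\![n]\!]$ by $\bar n < \dots < \bar 1 < 1 < \dots < n$; write $a \ll b$ if some $c \in [\![n]\!]$ satisfies $a<c<b$. The cyclic successor $i^+$ is the next element in this order, with $n^+ := \bar n$. A circular descent of $w$ is $i \in [\![n]\!]$ with $w(i) > w(i^+)$; $\operatorname{cdes}(w)$ is their number. Relation: for $u,w\in X_n$, $u \rightharpoonup w$ iff one of: (1) $w_1 \ge 2$ and $u = \bar{w_1} w_2 \cdots w_n$; (2) for some $i \in\{1,\dots,n-1\}$, $w_i \ll w_{i+1}$ and $u$ is obtained from $w$ by swapping the entries in positions $i$ and $i+1$; (3) $w_n \le \bar 2$ and $u = w_1\cdots w_{n-1}\bar{w_n}$. Geometry: positive roots of type $C_n$ are $\Phi^+ = \{e_j \pm e_i : 1 \le i<j\le n\} \cup \{2e_i : i \in [n]\}$. The affine arrangement consists of the hyperplanes $H_{\alpha,m}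 := \{x\in\mathbb{R}^n : \langle x,\alpha\rangle = m\}$ for $\alpha\in\Phi^+$, $m\in\mathbb{Z}$; alcoves are the closures of the connected components of the complement of their union. The fundamental alcove is $A_\circ := \{x : 0 \le \langle x,\alpha\rangle \le 1 \ \forall \alpha\in\Phi^+\}$. The weak order on alcoves: $A \le A'$ iff every hyperplane of the arrangement separating $A_\circ$ and $A$ also separates $A_\circ$ and $A'$. $\Pi_{C_n} := \{x \in \mathbb{R}^n \mid 0 \le 2x_1 \le 1,\ 0 \le x_i - x_{i-1} \le 1 \ (2 \le i \le n)\}$, and $\mathcal{I}_{C_n}$ is the set of alcoves contained in $\Pi_{C_n}$ with the weak order. For $1\le k\le 2n-1$, $\Delta_{C_n,k} := \{x \in \Pi_{C_n} \mid k-1 \le 2x_n \le k\}$. *)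

(* Defs.v *)
(* This development uses MathComp and MathComp-Analysis. *)
From HB Require Import structures.
From mathcomp Require Import all_boot all_order all_algebra all_fingroup.
From mathcomp Require Import all_classical all_reals all_analysis.
From mathcomp Require Import zify.

Set Implicit Arguments.
Unset Strict Implicit.
Unset Printing Implicit Defensive.

Import Order.TTheory GRing.Theory Num.Theory.
Import numFieldNormedType.Exports.

Local Open Scope classical_set_scope.
Local Open Scope ring_scope.

(* [sint n] is the set {-n, ..., -1, 1, ..., n}, ordered as a subset of int.  *)
Record sint (n : nat) := SInt {
  sint_val :> int;
  _ : (sint_val != 0) && (`|sint_val| <= n%:Z)
}.

HB.instance Definition _ n := [isSub for @sint_val n].
HB.instance Definition _ n := [Countable of sint n by <:].

Section SintFinite.
Variable n : nat.

Definition sint_code (i : sint n) : 'I_(n.*2.+1) := inord (absz ((i : int) + n%:Z)).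

Definition sint_decode (k : 'I_(n.*2.+1)) : option (sint n) :=
  insub ((k : nat)%:Z - n%:Z).

Lemma sint_codeK : pcancel sint_code sint_decode.
Proof.
move=> i; rewrite /sint_code /sint_decode; have := valP i => /= /andP[i0 ile].
have -> : ((inord (absz ((i : int) + n%:Z)) : 'I_(n.*2.+1)) : nat)%:Z - n%:Z = val i.
  rewrite inordK /=; lia.
by rewrite valK.
Qed.

HB.instance Definition _ :=
  fintype.isFinite.Build (sint n) (pcan_enumP sint_codeK).

End SintFinite.

Section SignedPermutations.
Variable n : nat.
Implicit Types (i j : sint n) (w : {perm sint n}).

Lemma sopp_subproof i : (- (i : int) != 0) && (`|- (i : int)| <= n%:Z).
Proof. by rewrite oppr_eq0 normrN; exact: valP i. Qed.

Definition sopp i : sint n := SInt (sopp_subproof i).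

Lemma spos_subproof (k : 'I_n) : (k.+1%:Z != 0) && (`|k.+1%:Z| <= n%:Z).
Proof. by have := ltn_ord k; lia. Qed.

(* Indices in {1, ..., n} are represented by the 0-based k : 'I_n. *)
Definition spos (k : 'I_n) : sint n := SInt (spos_subproof k).

Definition signed_perm w : bool := [forall i, w (sopp i) == sopp (w i)].

Definition far_below i j : bool :=
  [exists c : sint n, ((i : int) < c) && ((c : int) < j)].

(* No element lies above i exactly when i = n, and then sopp i = -n. *)
Definition csucc i : sint n :=
  if [pick j : sint n | ((i : int) < j) &&
        [forall k : sint n, ((i : int) < k) ==> ((j : int) <= k)]] is Some j
  then j else sopp i.

Definition cdes w : nat := #|[set i | ((w (csucc i) : int) < w i)%R]%SET|.

Definition window w (k : 'I_n) : sint n := w (spos k).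

Hypothesis n_gt0 : (0 < n)%N.

Definition ofirst : 'I_n := Ordinal n_gt0.
Definition olast : 'I_n := rev_ord ofirst.

Definition Xn : Type :=
  {w : {perm sint n} |
    signed_perm w && (0 < ((w^-1)%g (spos ofirst) : int))}.

HB.instance Definition _ := Finite.on Xn.

Definition harpoon (u w : Xn) : Prop :=
  let u := window (val u) in let w := window (val w) in
  [\/ 2 <= (w ofirst : int) /\
      (forall k, u k = if k == ofirst then sopp (w k) else w k),
      exists i j : 'I_n,
        [/\ j = i.+1 :> nat, far_below (w i) (w j)
          & forall k, u k = w (tperm i j k)]
    | (w olast : int) <= - 2 /\
      (forall k, u k = if k == olast then sopp (w k) else w k)].

End SignedPermutations.

Definition is_partial_order (T : Type) (le : rel T) : Prop :=
  [/\ reflexive le, antisymmetric le & transitive le].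

Definition is_covered_by (T : Type) (le : rel T) (u w : T) : Prop :=
  [/\ le u w, u <> w & forall v, le u v -> le v w -> v = u \/ v = w].

Section Alcoves.
Variables (R : realType) (n : nat).
Implicit Types (x a : 'rV[R]_n) (A B : set 'rV[R]_n).

Definition dot x a : R := \sum_(i < n) x 0 i * a 0 i.

Definition stdb (i : 'I_n) : 'rV[R]_n := delta_mx 0 i.

Definition pos_roots : set 'rV[R]_n :=
  [set a | (exists i j : 'I_n,
              (i < j)%N /\ (a = stdb j + stdb i \/ a = stdb j - stdb i))
           \/ (exists i : 'I_n, a = 2 *: stdb i)].

Definition hyperplane a (m : int) : set 'rV[R]_n := [set x | dot x a = m%:~R].

Definition arrangement_compl : set 'rV[R]_n :=
  ~` (\bigcup_(a in pos_roots) \bigcup_(m in [set: int]) hyperplane a m).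

Definition alcove A : Prop :=
  exists2 x, arrangement_compl x
           & A = closure (connected_component arrangement_compl x).

Definition fund_alcove : set 'rV[R]_n :=
  [set x | forall a, pos_roots a -> 0 <= dot x a <= 1].

(* Closed half-spaces suffice here: an alcove has nonempty interior, so it is *)
(* never contained in the hyperplane.                                         *)
Definition separates a (m : int) A B : Prop :=
  ((forall x, A x -> dot x a <= m%:~R) /\ (forall x, B x -> m%:~R <= dot x a))
  \/
  ((forall x, A x -> m%:~R <= dot x a) /\ (forall x, B x -> dot x a <= m%:~R)).

Definition weak_le A B : Prop :=
  forall a m, pos_roots a ->
    separates a m fund_alcove A -> separates a m fund_alcove B.

Hypothesis n_gt0 : (0 < n)%N.

Definition PiC : set 'rV[R]_n :=
  [set x | 0 <= 2 * x 0 (ofirst n_gt0) <= 1 /\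
           (forall i j : 'I_n, j = i.+1 :> nat -> 0 <= x 0 j - x 0 i <= 1)].

Definition IC : set (set 'rV[R]_n) := [set A | alcove A /\ A `<=` PiC].

Definition hypersimplex (k : nat) : set 'rV[R]_n :=
  [set x | PiC x /\ k%:R - 1 <= 2 * x 0 (olast n_gt0) <= k%:R].

End Alcoves.

Arguments IC R {n} n_gt0 _.
Arguments hypersimplex R {n} n_gt0 k _.

(* Main.v *)
(* Put v = w^-1 and extend a point x of R^n to an odd function on the signed *)
(* integers. The positive roots are then exactly the gaps x |-> x_d - x_c for *)
(* c < d, a pair and its mirror (-d, -c) giving the same root. Reducing the   *)
(* coordinates of a generic point of the polytope modulo 1 to (-1/2, 1/2)     *)
(* leaves the signed permutation v recording their relative order; the integer *)
(* parts (the heights) are forced, since they grow by 1 precisely at the      *)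
(* descents of v. So alcoves in the polytope correspond to X_n, the floor of a *)
(* gap being height d - height c - [v d < v c].                               *)
(* All gaps are nonnegative on the polytope, so the weak order is the         *)
(* componentwise order on these floors. The walls of the alcove of w are the  *)
(* pairs of positions w(i), w(i^+); crossing one changes a single floor, and  *)
(* the condition w(i) << w(i^+) says that crossing it lowers that floor. If   *)
(* u < w then u lies beyond some wall of w, and that wall can be crossed while *)
(* staying above u, whence the covering relations.                            *)

Require Import Defs.
From mathcomp Require Import all_boot all_order all_algebra all_fingroup.
From mathcomp Require Import all_classical all_reals all_analysis.
From mathcomp Require Import zify ring lra.

Set Implicit Arguments.
Unset Strict Implicit.
Unset Printing Implicit Defensive.

Import Order.TTheory GRing.Theory Num.Theory.
Import numFieldNormedType.Exports.

Local Open Scope classical_set_scope.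
Local Open Scope ring_scope.

(** * Order on signed integers *)

Section SignedIntegers.
Variable n : nat.
Implicit Types c d e i j k : sint n.

(** Each alcove is determined by the integer parts of all gaps x_d - x_c, so both orders are read
    from the integers [level w c d]. On the polytope the integer parts of the coordinates are forced
    ([height_unique]), hence every generic point lies in some [cell w] ([cell_exists]), and w is
    recovered from its levels ([level_inj]). The hyperplanes between the fundamental alcove and that
    of w are the values 1, ..., [level w c d] ([separates_level]), so the weak order is the
    componentwise order [weak]. The gap from -n to n is 2 x_n, with floor cdes(w^-1) - 1
    ([cdes_level]).

    A harpoon step crosses one wall ([harpoonP]) and lowers a single level, up to mirror, by 1
    ([level_move]), so nothing fits in between ([move_covered]). Conversely, if u < w, a point of
    the alcove of u violates an inequality defining the alcove of w ([eq_of_relative_pos]). Crossing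
    the corresponding wall lowers a level of w exceeding that of u, so the result stays above u
    ([exists_move]), and a cover must be such a step. *)

Lemma sintP c : (c : int) <> 0 /\ - n%:Z <= (c : int) <= n%:Z.
Proof. by case: c => z /= /andP[]; lia. Qed.

Lemma sint_inj c d : (c : int) = d -> c = d.
Proof. exact: val_inj. Qed.

Lemma sint_of (z : int) : z <> 0 -> - n%:Z <= z <= n%:Z ->
  exists c : sint n, (c : int) = z.
Proof.
move=> z0 zn; have h : (z != 0) && (`|z| <= n%:Z) by lia.
by exists (SInt h).
Qed.

Lemma soppK : involutive (@sopp n).
Proof. by move=> c; apply: sint_inj; rewrite /= opprK. Qed.

Lemma sint_spos c : exists k : 'I_n, c = spos k \/ c = sopp (spos k).
Proof.
have [c0 cn] := sintP c.
have h : (`|(c : int)|.-1 < n)%N by lia.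
exists (Ordinal h); case: (ltrP 0 (c : int)) => c_gt0; [left|right];
  apply: sint_inj => /=; lia.
Qed.

Lemma sint_pos c : 0 < (c : int) -> exists k : 'I_n, c = spos k.
Proof.
have [k [->|->]] := sint_spos c; first by exists k.
by rewrite /=; lia.
Qed.

Definition adjacent c d : bool := ((c : int) < d) && ~~ far_below c d.

Lemma adjacentP c d :
  adjacent c d <-> (d : int) = (c : int) + 1 \/ (c : int) = -1 /\ (d : int) = 1.
Proof.
have [c0 cn] := sintP c; have [d0 dn] := sintP d.
split=> [/andP[cd nfar]|h].
  have aux (z : int) : z <> 0 -> (c : int) < z < (d : int) -> False.
    move=> z0 czd; have [|e ez] := @sint_of z z0; first lia.
    by move: nfar => /existsP[]; exists e; rewrite ez.
  have h1 := aux ((c : int) + 1); have h2 := aux ((c : int) + 2); lia.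
rewrite /adjacent; apply/andP; split; first by lia.
by apply/negP=> /existsP[e]; have [] := sintP e; lia.
Qed.

Lemma adjacent_sopp c d : adjacent c d -> adjacent (sopp d) (sopp c).
Proof. by move=> /adjacentP h; apply/adjacentP => /=; lia. Qed.

Lemma adjacent_lt c d : adjacent c d -> (c : int) < d.
Proof. by case/andP. Qed.

Lemma csucc_adjacent c d : adjacent c d -> csucc c = d.
Proof.
move=> /adjacentP cd; rewrite /csucc; case: pickP => [e /andP[ce]|/(_ d)].
  move=> /forallP/(_ d)/implyP h; apply: sint_inj.
  by have [] := sintP e; have [] := sintP d; lia.
have -> : (c : int) < d by lia.
move=> /negbT/forallPn[k]; rewrite negb_imply.
by have [] := sintP k; lia.
Qed.

Lemma csucc_top c : (c : int) = n%:Z -> csucc c = sopp c.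
Proof.
move=> cn; rewrite /csucc; case: pickP => [e /andP[]|//].
by have [] := sintP e; lia.
Qed.

Lemma adjacent_ind (P : sint n -> sint n -> Prop) :
  (forall c d e, P c d -> P d e -> P c e) ->
  (forall c d, adjacent c d -> P c d) ->
  forall c d, (c : int) < d -> P c d.
Proof.
move=> Ptrans Padj c d; have [k] := ubnP `|(d : int) - c|%N.
elim: k c d => // k IH c d dc_k cd.
have [/existsP[e /andP[ce ed]]|nfar] := boolP (far_below c d).
  by apply: (Ptrans c e d); apply: IH; lia.
by apply: Padj; rewrite /adjacent cd.
Qed.

Lemma adjacent_homo (f : sint n -> int) :
  (forall c d, adjacent c d -> f c < f d) ->
  forall c d, (c : int) < d -> f c < f d.
Proof. by move=> h; apply: adjacent_ind => // c d e; apply: lt_trans. Qed.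

Lemma adjacent_const (f : sint n -> int) :
  (forall c d, adjacent c d -> f c = f d) -> forall c d, f c = f d.
Proof.
move=> h; have h' := @adjacent_ind (fun c d => f c = f d) _ h.
move=> c d; have {}h' c' d' : (c' : int) < d' -> f c' = f d'.
  by apply: h' => ? ? ? ->.
by have [/h'|/h'|/sint_inj->] := ltrgtP (c : int) (d : int).
Qed.

(** Equal increments make f - g constant, and an odd constant is zero; oddness thus replaces an
    initial value. *)
Lemma odd_adjacent_eq (f g : sint n -> int) :
  (forall c, f (sopp c) = - f c) -> (forall c, g (sopp c) = - g c) ->
  (forall c d, adjacent c d -> f d - f c = g d - g c) -> f =1 g.
Proof.
move=> fN gN fg c.
have : f c - g c = f (sopp c) - g (sopp c).
  by apply: (adjacent_const (f := fun c => f c - g c)) => {}c d /fg; lia.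
by rewrite fN gN; lia.
Qed.

(** * Permutations from order comparisons *)

Definition rank (T : realDomainType) (f : sint n -> T) c : nat :=
  #|[set e | f e < f c]%SET|.

Lemma rank_lt (T : realDomainType) (f : sint n -> T) c d :
  (rank f c < rank f d)%N = (f c < f d).
Proof.
have mono c' d' : f c' <= f d' -> (rank f c' <= rank f d')%N.
  move=> cd; apply: subset_leq_card; apply/fintype.subsetP=> e; rewrite !inE.
  by move=> /lt_le_trans; apply.
have [cd|dc] := ltrP (f c) (f d); last by have := mono _ _ dc; lia.
apply: proper_card; apply/properP; split.
  by apply/fintype.subsetP=> e; rewrite !inE => /lt_trans; apply.
by exists c; rewrite !inE ?ltxx.
Qed.

Lemma rank_ltn (T : realDomainType) (f : sint n -> T) c :
  (rank f c < #|{: sint n}|)%N.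
Proof.
rewrite -cardsT; apply: proper_card; apply/properP; split.
  exact: finset.subsetT.
by exists c; rewrite !inE ?ltxx.
Qed.

Lemma ltr_inj_sint (T : realDomainType) (f : sint n -> T) c d :
  injective f -> ~~ (f c < f d) -> ~~ (f d < f c) -> c = d.
Proof. by move=> finj; case: ltrgtP => // /finj. Qed.

Lemma rank_perm (s : {perm sint n}) c :
  rank (fun e => s e : int) c = rank (@sint_val n) (s c).
Proof.
rewrite /rank -(card_imset _ (@perm_inj _ s)); apply: eq_card => e.
rewrite !inE; apply/imsetP/idP => [[d]|es]; first by rewrite inE => h ->.
by exists ((s^-1)%g e); rewrite ?inE permKV.
Qed.

Lemma perm_ltr_eq (s t : {perm sint n}) :
  (forall c d, ((s c : int) < s d) = ((t c : int) < t d)) -> s = t.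
Proof.
move=> st; apply/permP=> c.
have : rank (@sint_val n) (s c) = rank (@sint_val n) (t c).
  by rewrite -!rank_perm; apply: eq_card => e; rewrite !inE st.
have := rank_lt (@sint_val n) (s c) (t c).
have := rank_lt (@sint_val n) (t c) (s c).
by move=> + + h; rewrite h ltnn => h1 h2; apply: sint_inj; lia.
Qed.

(** Standardization: each value of f is replaced by the signed integer of the same rank. *)
Lemma perm_of_ltr (T : realDomainType) (f : sint n -> T) : injective f ->
  exists s : {perm sint n}, forall c d, ((s c : int) < s d) = (f c < f d).
Proof.
move=> finj.
have inj (T' : realDomainType) (g : sint n -> T') : injective g ->
    injective (fun c => Ordinal (rank_ltn g c)).
  move=> ginj c d /(congr1 val) /= h.
  by apply: (ltr_inj_sint ginj); rewrite -rank_lt h ltnn.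
have [||r rK Kr] := inj_card_bij (inj _ (@sint_val n) _).
- exact: sint_inj.
- by rewrite card_ord.
have sinj : injective (fun c => r (Ordinal (rank_ltn f c))).
  exact: inj_comp (can_inj Kr) (inj _ _ finj).
exists (perm sinj) => c d; rewrite !permE -!rank_lt.
by have := Kr (Ordinal (rank_ltn f c)); have := Kr (Ordinal (rank_ltn f d));
  move=> /(congr1 val) /= -> /(congr1 val) /= ->.
Qed.

Lemma far_belowP c d : far_below c d <->
  [/\ (c : int) < d, (d : int) <> (c : int) + 1
    & ~ ((c : int) = -1 /\ (d : int) = 1)].
Proof.
have := adjacentP c d; rewrite /adjacent.
have [/existsP[e ced]|_] := boolP (far_below c d); case: ltrP => cd /=.
- by move=> h; split=> // _; split=> // e1; apply: notF; apply/h; lia.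
- by lia.
- by move=> h; split=> // -[_ h1 h2]; have := h.1 isT; lia.
- by move=> h; split=> // -[]; lia.
Qed.

(** The signed transposition (i j)(-i -j); for j = -i it is the single transposition (i -i), so one
    formula covers swaps and sign changes. *)
Definition cswap i j k : sint n :=
  if k == i then j else if k == j then i else
  if k == sopp i then sopp j else if k == sopp j then sopp i else k.

Lemma cswapP i j k : let r := cswap i j k in
  [\/ (k : int) = i /\ (r : int) = j, (k : int) = j /\ (r : int) = i,
      (k : int) = - (i : int) /\ (r : int) = - (j : int)
    | (k : int) = - (j : int) /\ (r : int) = - (i : int)] \/
  [/\ (k : int) <> i, (k : int) <> j, (k : int) <> - (i : int),
      (k : int) <> - (j : int) & (r : int) = k].
Proof.
have ne c d : c <> d -> (c : int) <> d by move=> cd /sint_inj.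
rewrite /cswap; case: eqVneq => [->|/eqP/ne ki]; first by left; constructor 1.
case: eqVneq => [->|/eqP/ne kj]; first by left; constructor 2.
case: eqVneq => [->|/eqP/ne kNi]; first by left; constructor 3.
by case: eqVneq => [->|/eqP/ne kNj]; [left; constructor 4|right].
Qed.

(** Nothing lies strictly between i and j, so only the comparison of these two and that of their
    mirror images can be reversed. *)
Lemma cswap_lt i j (p q : sint n) : adjacent i j ->
  [\/ (p : int) = i /\ (q : int) = j, (p : int) = j /\ (q : int) = i,
      (p : int) = - (j : int) /\ (q : int) = - (i : int)
    | (p : int) = - (i : int) /\ (q : int) = - (j : int)] \/
  ((cswap i j p : int) < cswap i j q) = ((p : int) < q).
Proof.
move=> /adjacentP ij; have := cswapP i j p; have := cswapP i j q => /=.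
move: (cswap i j p : int) (cswap i j q : int) => p' q'.
have [i0 _] := sintP i; have [j0 _] := sintP j.
have [p0 _] := sintP p; have [q0 _] := sintP q.
move: (i : int) (j : int) (p : int) (q : int) ij i0 j0 p0 q0 => {}i {}j {}p {}q.
move=> ij i0 j0 p0 q0.
have aux : (p' < q' -> p < q) -> (p < q -> p' < q') -> (p' < q') = (p < q).
  by move=> ? ?; apply/idP/idP.
move: i0 j0; case: ij => [->|[-> ->]] i0 j0;
  move=> [[] [? ?]|[? ? ? ? ?]] [[] [? ?]|[? ? ? ? ?]];
  solve [ by left; constructor 1; lia | by left; constructor 2; lia
        | by left; constructor 3; lia | by left; constructor 4; lia
        | by right; apply: aux; lia ].
Qed.

Lemma cswapK i j : involutive (cswap i j).
Proof.
move=> k; apply: sint_inj.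
have := cswapP i j k; have /= := cswapP i j (cswap i j k).
have [i0 _] := sintP i; have [j0 _] := sintP j.
case=> [[] [? ?]|[? ? ? ? ?]]; case=> [[] [? ?]|[? ? ? ? ?]]; lia.
Qed.

Lemma cswap_sopp i j k : cswap i j (sopp k) = sopp (cswap i j k).
Proof.
apply: sint_inj.
have := cswapP i j k; have /= := cswapP i j (sopp k).
have [i0 _] := sintP i; have [j0 _] := sintP j.
have [k0 _] := sintP k.
case=> [[] [? ?]|[? ? ? ? ?]]; case=> [[] [? ?]|[? ? ? ? ?]] /=; lia.
Qed.

Lemma cswapN i j : cswap (sopp j) (sopp i) =1 cswap i j.
Proof.
move=> k; apply: sint_inj.
have := cswapP i j k; have /= := cswapP (sopp j) (sopp i) k.
have [i0 _] := sintP i; have [j0 _] := sintP j.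
case=> [[] [? ?]|[? ? ? ? ?]]; case=> [[] [? ?]|[? ? ? ? ?]] /=; lia.
Qed.

End SignedIntegers.

(** * Heights and levels of a signed permutation *)

Section Levels.
Variables (n : nat) (n_gt0 : (0 < n)%N).
Implicit Types (c d e i j k : sint n) (u w : Xn n_gt0).

Local Notation one := (spos (ofirst n_gt0)).
Local Notation top := (spos (olast n_gt0)).

Definition pos w c : int := ((val w)^-1)%g c.

Lemma topE : (top : int) = n%:Z.
Proof. by rewrite /=; lia. Qed.

Lemma val_sopp w c : val w (sopp c) = sopp (val w c).
Proof. by case: w => /= w /andP[/forallP/(_ c)/eqP]. Qed.

Lemma inv_sopp w c : ((val w)^-1)%g (sopp c) = sopp (((val w)^-1)%g c).
Proof. by apply: (@perm_inj _ (val w)); rewrite val_sopp !permKV. Qed.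

Lemma pos_sopp w c : pos w (sopp c) = - pos w c.
Proof. by rewrite /pos inv_sopp. Qed.

Lemma pos_inj w : injective (pos w).
Proof. by move=> c d /sint_inj/perm_inj. Qed.

Lemma pos_val w k : pos w (val w k) = k.
Proof. by rewrite /pos permK. Qed.

Lemma posP w c : pos w c <> 0 /\ - n%:Z <= pos w c <= n%:Z.
Proof. exact: sintP. Qed.

Lemma pos_eq w c d : pos w c = pos w d <-> (c : int) = d.
Proof. by split=> [/pos_inj->|/sint_inj->]. Qed.

Lemma pos_eqN w c d : pos w c = - pos w d <-> (c : int) = - (d : int).
Proof. by rewrite -pos_sopp pos_eq. Qed.

Lemma pos_one_gt0 w : 0 < pos w one.
Proof. by rewrite /pos; case: w => /= w /andP[]. Qed.

Lemma adjacent_opp_pos w c d : adjacent c d -> (d : int) = - (c : int) ->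
  pos w c < 0 < pos w d.
Proof.
move=> /adjacentP cd dc; have := pos_one_gt0 w.
have -> : d = one by apply: sint_inj => /=; lia.
have -> : c = sopp one by apply: sint_inj => /=; lia.
by rewrite pos_sopp; lia.
Qed.

(* Descents of w^-1 are counted from -n upwards, so that the last value gives *)
(* cdes; the shift in [height] then makes the height an odd function.         *)
Definition num_descents w c : nat :=
  #|[set e : sint n | ((e : int) < c)%R && (pos w (csucc e) < pos w e)%R]%SET|.

Definition height w c : int := (num_descents w c)%:Z - (num_descents w one)%:Z.

Lemma num_descents_adjacent w c d : adjacent c d ->
  num_descents w d = ((pos w d < pos w c)%R + num_descents w c)%N.
Proof.
move=> cd; rewrite /num_descents.
rewrite (cardsD1 c) !inE (csucc_adjacent cd) (adjacent_lt cd) /=; congr addn.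
apply: eq_card => e; rewrite !inE andbA; congr (_ && _).
move: cd => /adjacentP cd; have [] := sintP e; have [] := sintP c.
have [->|/eqP ec] := eqVneq e c; first by rewrite /= ltxx.
have : (e : int) <> c by move=> /sint_inj.
by rewrite /=; lia.
Qed.

Lemma height_adjacent w c d : adjacent c d ->
  height w d - height w c = (pos w d < pos w c)%R%:Z.
Proof. by move=> cd; rewrite /height (num_descents_adjacent w cd); lia. Qed.

(** Descents are symmetric under negation, so the counts at c and -c have a constant sum. The counts
    at -1 and 1 agree because membership in X_n excludes a descent there. *)
Lemma height_sopp w c : height w (sopp c) = - height w c.
Proof.
have h d : (num_descents w d)%:Z + (num_descents w (sopp d))%:Z
         = (num_descents w one)%:Z + (num_descents w (sopp one))%:Z.
  apply: (adjacent_const (f := fun d => (num_descents w d)%:Z +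
                                     (num_descents w (sopp d))%:Z)) => {}c e ce.
  rewrite (num_descents_adjacent w ce).
  rewrite (num_descents_adjacent w (adjacent_sopp ce)) !pos_sopp; lia.
have h1 : num_descents w one = num_descents w (sopp one).
  have adj : adjacent (sopp one) one by apply/adjacentP => /=; lia.
  by rewrite (num_descents_adjacent w adj) pos_sopp; have := pos_one_gt0 w; lia.
by have := h c; rewrite /height -h1; lia.
Qed.

Lemma height_unique w (f : sint n -> int) :
  (forall c, f (sopp c) = - f c) ->
  (forall c d, adjacent c d -> f d - f c = (pos w d < pos w c)%R%:Z) ->
  f =1 height w.
Proof.
move=> fN fadj; apply: odd_adjacent_eq => //; first exact: height_sopp.
by move=> c d cd; rewrite fadj // height_adjacent.
Qed.

(* The floor of x_d - x_c on the alcove of w. *)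
Definition level w c d : int := height w d - height w c - (pos w d < pos w c)%R%:Z.

Lemma level_adjacent w c d : adjacent c d -> level w c d = 0.
Proof. by move=> /height_adjacent h; rewrite /level h subrr. Qed.

Lemma level_sopp w c d : level w (sopp d) (sopp c) = level w c d.
Proof. by rewrite /level !height_sopp !pos_sopp; lia. Qed.

(* A point inside the alcove of w, rescaled by 2n + 1 to be integral. *)
Definition lifted_pos w c : int := (n.*2.+1)%:Z * height w c + pos w c.

Lemma lifted_pos_sopp w c : lifted_pos w (sopp c) = - lifted_pos w c.
Proof. by rewrite /lifted_pos height_sopp pos_sopp; lia. Qed.

Lemma level_bounds w c d : c <> d ->
  (n.*2.+1)%:Z * level w c d < lifted_pos w d - lifted_pos w c
    < (n.*2.+1)%:Z * (level w c d + 1).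
Proof.
move=> cd; have ncd : pos w c <> pos w d by move/pos_inj.
have [_ cn] := posP w c; have [_ dn] := posP w d.
rewrite /lifted_pos /level.
by case: (ltrP (pos w d) (pos w c)) => h /=; nia.
Qed.

Lemma lifted_pos_lt w c d : (c : int) < d -> lifted_pos w c < lifted_pos w d.
Proof.
apply: adjacent_homo => {}c {}d cd.
have ncd : c <> d by move=> e; move: (adjacent_lt cd); rewrite e ltxx.
by have := level_bounds w ncd; rewrite (level_adjacent w cd); lia.
Qed.

Lemma level_ge0 w c d : (c : int) < d -> 0 <= level w c d.
Proof.
move=> cd; have := lifted_pos_lt w cd.
have h : c <> d by move=> e; move: cd; rewrite e ltxx.
by have := level_bounds w h; nia.
Qed.

(** Adjacent gaps are below 1 and the first coordinate is below 1/2, so x_n < n - 1/2; this is the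
    integral form after scaling by 2n + 1. *)
Lemma lifted_pos_top w :
  lifted_pos w top <= (n.*2.+1)%:Z * n%:Z - n%:Z - 1.
Proof.
have h c d : adjacent c d ->
    (n.*2.+1)%:Z * (c : int) - lifted_pos w c
    < (n.*2.+1)%:Z * (d : int) - lifted_pos w d.
  move=> cd; have ncd : c <> d by move=> e; move: (adjacent_lt cd); rewrite e ltxx.
  have := level_bounds w ncd; rewrite (level_adjacent w cd).
  by move/adjacentP: cd; nia.
have := adjacent_homo h (c := one) (d := top).
have oneE : lifted_pos w one = pos w one by rewrite /lifted_pos /height; lia.
have [_] := posP w one; have o1 : (one : int) = 1 by [].
rewrite topE o1 oneE; case: (ltrP 1 n%:Z) => n1 p1; first by move=> /(_ isT); nia.
have -> : top = one by apply: sint_inj; rewrite topE o1; lia.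
by rewrite oneE; nia.
Qed.

(** The descents below n add up to the height difference from -n to n. The wrap-around from n to -n
    is a descent exactly when the correction subtracted in [level] vanishes, whence the extra 1. *)
Lemma cdes_level w : (cdes ((val w)^-1)%g)%:Z = level w (sopp top) top + 1.
Proof.
have D0 : num_descents w (sopp top) = 0%N.
  apply/eqP; rewrite cards_eq0; apply/eqP/setP => e; rewrite !inE /=.
  by have [_] := sintP e; have := topE; lia.
have := height_sopp w top; rewrite /level {1 2}/height D0 => h.
have -> : cdes ((val w)^-1)%g
        = ((0 < pos w top)%R + num_descents w top)%N.
  rewrite /cdes (cardsD1 top) inE (csucc_top topE) -!/(pos w _) pos_sopp.
  congr addn; first by congr nat_of_bool; lia.
  apply: eq_card => e; rewrite !inE; congr (_ && _).
  have [_ ?] := sintP e; have [->|/eqP ec] := eqVneq e top; first by rewrite ltxx.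
  have : (e : int) <> top by move=> /sint_inj.
  by have := topE; lia.
by have [] := posP w top; rewrite /level pos_sopp /height; lia.
Qed.

(** The level from -c to c is twice the height minus the indicator of a negative position, so its
    parity separates the two. With heights known, the remaining levels give all comparisons of
    positions. *)
Lemma level_inj u w :
  (forall c d, (c : int) < d -> level u c d = level w c d) -> u = w.
Proof.
move=> uw.
have sgn c : height u c = height w c /\ (pos u c < 0) = (pos w c < 0).
  wlog c_gt0 : c / 0 < (c : int).
    move=> H; have [c0 _] := sintP c; case: (ltrP 0 (c : int)) => [/H//|c_le0].
    have /H : 0 < (sopp c : int) by rewrite /=; lia.
    rewrite !height_sopp !pos_sopp.
    by have [] := posP u c; have [] := posP w c; lia.
  have : ((sopp c) : int) < c by rewrite /=; lia.
  by move=> /uw; rewrite /level !height_sopp !pos_sopp; lia.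
apply: val_inj; apply: invg_inj; apply: perm_ltr_eq => d c.
rewrite -/(pos u c) -/(pos u d) -/(pos w c) -/(pos w d).
have aux e e' : (e : int) < e' -> (pos u e' < pos u e) = (pos w e' < pos w e).
  by move=> /uw; rewrite /level (sgn e).1 (sgn e').1; lia.
have [/aux h|/aux//|/sint_inj->] := ltrgtP (d : int) (c : int); last first.
  by rewrite !ltxx.
have := pos_eq u d c; have := pos_eq w d c; lia.
Qed.

End Levels.

(** * Crossing a wall *)

Section Moves.
Variables (n : nat) (n_gt0 : (0 < n)%N).
Implicit Types (c d e i j k : sint n) (u w : Xn n_gt0).

Local Notation one := (spos (ofirst n_gt0)).
Local Notation top := (spos (olast n_gt0)).

(* The second case is the pair (n, n^+). *)
Definition wall i j : Prop := adjacent i j \/ i = top /\ j = sopp top.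

Definition move_at u w i j : Prop :=
  [/\ wall i j, far_below (val w i) (val w j)
    & forall k, val u k = val w (cswap i j k)].

Lemma move_pos u w i j c : move_at u w i j ->
  ((val u)^-1)%g c = cswap i j (((val w)^-1)%g c).
Proof.
by move=> [_ _ uw]; apply: (@perm_inj _ (val u)); rewrite permKV uw cswapK permKV.
Qed.

Lemma move_at_val u w i j : move_at u w i j ->
  pos u (val w i) = j /\ pos u (val w j) = i.
Proof.
move=> m.
have E k : pos u (val w k) = cswap i j k.
  by rewrite /pos (move_pos _ m) permK.
by rewrite !E /cswap !eqxx; split=> //; case: eqVneq => // ->.
Qed.

Lemma move_lt u w i j c d : adjacent i j -> move_at u w i j ->
  let a : int := val w i in let b : int := val w j in
  [\/ (c : int) = a /\ (d : int) = b, (c : int) = b /\ (d : int) = a,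
      (c : int) = - b /\ (d : int) = - a | (c : int) = - a /\ (d : int) = - b] \/
  (pos u c < pos u d) = (pos w c < pos w d).
Proof.
move=> ij m a b.
have -> : pos u c = cswap i j (((val w)^-1)%g c) by rewrite -(move_pos c m).
have -> : pos u d = cswap i j (((val w)^-1)%g d) by rewrite -(move_pos d m).
have := cswap_lt (((val w)^-1)%g c) (((val w)^-1)%g d) ij.
rewrite -/(pos w c) -/(pos w d) /= -(pos_val w i) -(pos_val w j).
case=> [[] [h1 h2]|->]; last by right.
- by left; constructor 1; split; [exact/pos_eq/h1|exact/pos_eq/h2].
- by left; constructor 2; split; [exact/pos_eq/h1|exact/pos_eq/h2].
- by left; constructor 3; split; [exact/pos_eqN/h1|exact/pos_eqN/h2].
- by left; constructor 4; split; [exact/pos_eqN/h1|exact/pos_eqN/h2].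
Qed.

(** The values whose comparison flips are not adjacent, so no descent between adjacent values
    changes. *)
Lemma height_move_adjacent u w i j : adjacent i j -> move_at u w i j ->
  height u =1 height w.
Proof.
move=> ij m c; apply/esym; apply: height_unique c => [|c d cd].
  exact: height_sopp.
rewrite height_adjacent //; congr (Posz (nat_of_bool _)).
have /far_belowP[] : far_below (val w i) (val w j) by case: m.
have := adjacent_opp_pos w cd; have := adjacent_opp_pos u cd.
move: (cd) => /adjacentP {}cd.
have [/= h|->//] := move_lt d c ij m.
have [c0 _] := sintP c; have [d0 _] := sintP d.
by case: h => -[]; lia.
Qed.

Lemma move_top_le u w : move_at u w top (sopp top) -> (val w top : int) <= -2.
Proof.
case=> _ /far_belowP + _; rewrite val_sopp /=.
by have [] := sintP (val w top); move=> ? ? []; lia.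
Qed.

Lemma move_top_pos u w c : move_at u w top (sopp top) ->
  let a : int := val w top in
  [\/ [/\ (c : int) = a, pos u c = - n%:Z & pos w c = n%:Z],
      [/\ (c : int) = - a, pos u c = n%:Z & pos w c = - n%:Z]
    | [/\ (c : int) <> a, (c : int) <> - a, pos u c = pos w c
        & - n%:Z < pos w c < n%:Z]].
Proof.
move=> m a; have -> : pos u c = cswap top (sopp top) (((val w)^-1)%g c).
  by rewrite -(move_pos c m).
have := cswapP top (sopp top) (((val w)^-1)%g c).
lazy zeta; move: (cswap _ _ _ : int) => p; rewrite -/(pos w c).
have -> : (sopp top : int) = - n%:Z by rewrite -topE.
rewrite topE opprK.
have wa : pos w (val w top) = n%:Z by rewrite pos_val topE.
have [_] := posP w c.
have := pos_eq w c (val w top); have := pos_eqN w c (val w top).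
rewrite wa -/a => -[h1 h2] [h3 h4] pn.
case=> [[] [h ->]|[h5 h6 _ _ ->]]; rewrite ?h ?opprK.
- by constructor 1; split=> //; exact: h3.
- by constructor 2; split=> //; exact: h1.
- by constructor 2; split=> //; exact: h1.
- by constructor 1; split=> //; exact: h3.
by constructor 3; split=> //; [move/h4|move/h2|lia].
Qed.

(** Crossing this wall moves the coordinate of w_n past a half-integer: it now rounds to the next
    integer, and its negative to the previous one. *)
Lemma height_move_top u w c : move_at u w top (sopp top) ->
  let a : int := val w top in
  height u c = height w c + ((c : int) == a)%:Z - ((c : int) == - a)%:Z.
Proof.
move=> m a; apply/esym.
pose f c := height w c + ((c : int) == a)%:Z - ((c : int) == - a)%:Z.
rewrite -/(f c); apply: (height_unique (f := f)) => {c} [c|c d cd].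
  by rewrite /f height_sopp /=; lia.
have := height_adjacent w cd; rewrite /f.
move: (height w c) (height w d) => hc hd.
have := move_top_le m; have := move_top_pos c m; have := move_top_pos d m.
rewrite -/a; clear f; clearbody a; move: cd => /adjacentP cd.
by case=> [[? ? ?]|[? ? ?]|[? ? ? ?]] [[? ? ?]|[? ? ?]|[? ? ? ?]] ?; lia.
Qed.

Lemma level_move u w i j c d : move_at u w i j -> (c : int) < d ->
  let a : int := val w i in let b : int := val w j in
  [\/ [/\ (c : int) = a, (d : int) = b & level u c d = level w c d - 1],
      [/\ (c : int) = - b, (d : int) = - a & level u c d = level w c d - 1]
    | [/\ ~ ((c : int) = a /\ (d : int) = b),
          ~ ((c : int) = - b /\ (d : int) = - a)
        & level u c d = level w c d]].
Proof.
move=> m cd a b.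
have mN (k l : sint n) : (k : int) = - (l : int) -> k = sopp l.
  by move=> ?; apply: sint_inj.
have /far_belowP[ab _ _] : far_below (val w i) (val w j) by case: m.
have [ij|[ie je]] : wall i j by case: m.
  rewrite /level !(height_move_adjacent ij m).
  have ij' := adjacent_lt ij; have [ua ub] := move_at_val m.
  have wa := pos_val w i; have wb := pos_val w j.
  have lev1 : (c : int) = a -> (d : int) = b ->
      (pos w d < pos w c) = false /\ (pos u d < pos u c) = true.
    by move=> /sint_inj-> /sint_inj->; rewrite ua ub wa wb; lia.
  have lev2 : (c : int) = - b -> (d : int) = - a ->
      (pos w d < pos w c) = false /\ (pos u d < pos u c) = true.
    by move=> /mN-> /mN->; rewrite !pos_sopp ua ub wa wb; lia.
  have [|e] := move_lt d c ij m; rewrite -/a -/b.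
    case=> -[hd hc]; try lia.
      by constructor 1; split=> //; case: (lev1 hc hd) => -> ->; lia.
    by constructor 2; split=> //; case: (lev2 hc hd) => -> ->; lia.
  constructor 3; rewrite e; split=> //.
    by move=> [/lev1 h /h]; rewrite e => -[->].
  by move=> [/lev2 h /h]; rewrite e => -[->].
subst i j; rewrite /level !(height_move_top _ m) -/a.
have -> : b = - a by rewrite /b val_sopp.
have := move_top_le m; have := move_top_pos c m; have := move_top_pos d m.
rewrite -/a; clear b ab; clearbody a.
case=> [[? ? ?]|[? ? ?]|[? ? ? ?]] [[? ? ?]|[? ? ?]|[? ? ? ?]] ?;
  solve [ lia | by constructor 1; split; lia | by constructor 3; split; lia ].
Qed.

End Moves.

(** * The combinatorial weak order and its covers *)

Section WeakOrder.
Variables (n : nat) (n_gt0 : (0 < n)%N).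
Implicit Types (c d e i j k : sint n) (u v w : Xn n_gt0).

Local Notation one := (spos (ofirst n_gt0)).
Local Notation top := (spos (olast n_gt0)).

(** * Harpoon steps as wall crossings *)

Lemma move_at_window u w i j : wall n_gt0 i j -> far_below (val w i) (val w j) ->
  (forall k : 'I_n, window (val u) k = val w (cswap i j (spos k))) ->
  move_at u w i j.
Proof.
move=> ij far h; split=> // k.
have [l [->|->]] := sint_spos k; first exact: h.
by rewrite cswap_sopp !val_sopp; congr sopp; exact: h.
Qed.

Lemma cswap_one (k : 'I_n) :
  cswap (sopp one) one (spos k) = if k == ofirst n_gt0 then sopp one else spos k.
Proof.
apply: sint_inj; have := cswapP (sopp one) one (spos k); lazy zeta.
move: (cswap _ _ _ : int) => q.
have [->|] := eqVneq k (ofirst n_gt0).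
  by rewrite /=; case=> [[] [? ?]|[? ? ? ? ?]]; lia.
by rewrite -val_eqE /= => ? [[] [? ?]|[? ? ? ? ?]]; lia.
Qed.

Lemma cswap_top (k : 'I_n) :
  cswap top (sopp top) (spos k) = if k == olast n_gt0 then sopp top else spos k.
Proof.
apply: sint_inj; have := cswapP top (sopp top) (spos k); lazy zeta.
move: (cswap _ _ _ : int) => q.
have [->|] := eqVneq k (olast n_gt0).
  by rewrite /=; case=> [[] [? ?]|[? ? ? ? ?]]; lia.
rewrite -val_eqE /=; have := ltn_ord k.
by move=> ? ? [[] [? ?]|[? ? ? ? ?]]; lia.
Qed.

Lemma cswap_tperm (i j k : 'I_n) :
  cswap (spos i) (spos j) (spos k) = spos (tperm i j k).
Proof.
apply: sint_inj; have := cswapP (spos i) (spos j) (spos k); lazy zeta.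
move: (cswap _ _ _ : int) => q.
case: tpermP => [->|->|].
- by rewrite /=; case=> [[] [? ?]|[? ? ? ? ?]]; lia.
- by rewrite /=; case=> [[] [? ?]|[? ? ? ? ?]]; lia.
move=> /eqP + /eqP; rewrite -!val_eqE /=.
by move=> ? ? [[] [? ?]|[? ? ? ? ?]]; lia.
Qed.

Lemma move_atN u w i j : adjacent i j -> move_at u w i j ->
  move_at u w (sopp j) (sopp i).
Proof.
move=> ij [_ /far_belowP[ab h1 h2] uw]; split.
- by left; apply: adjacent_sopp.
- by move: ab h1 h2; rewrite far_belowP !(val_sopp w) /= => *; split; lia.
by move=> k; rewrite cswapN uw.
Qed.

Lemma harpoonP u w : harpoon u w <-> exists i j, move_at u w i j.
Proof.
rewrite /harpoon; split=> [[[w1 h]|[i [j [ij far h]]]|[w1 h]]|[i [j m]]].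
- exists (sopp one), one; apply: move_at_window => [||k].
  + by left; apply/adjacentP => /=; lia.
  + apply/far_belowP; move: w1; rewrite /window (val_sopp w) /= => ?; split; lia.
  + by rewrite h cswap_one; case: eqVneq => // ->; rewrite (val_sopp w).
- exists (spos i), (spos j); apply: move_at_window => [||k] //.
    by left; apply/adjacentP => /=; lia.
  by rewrite h cswap_tperm.
- exists top, (sopp top); apply: move_at_window => [||k].
  + by right.
  + by apply/far_belowP; move: w1; rewrite /window (val_sopp w) /= => ?; split; lia.
  + by rewrite h cswap_top; case: eqVneq => // ->; rewrite (val_sopp w).
have [ij|[ie je]] : wall n_gt0 i j by case: m.
  (* The wall (i, j) and its mirror (-j, -i) define the same crossing, so j may be taken
     positive. *)
  wlog j_gt0 : i j m ij / 0 < (j : int).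
    move=> H; case: (ltrP 0 (j : int)) => [|j_le0]; first exact: H m ij.
    apply: (H _ _ (move_atN ij m) (adjacent_sopp ij)) => /=.
    by have [] := sintP i; move: ij => /adjacentP; lia.
  have [[i1 j1]|i_gt0] : (i : int) = -1 /\ (j : int) = 1 \/ 0 < (i : int).
    by move: ij => /adjacentP; have [] := sintP i; lia.
    have je : j = one by apply: sint_inj.
    have ie : i = sopp one by apply: sint_inj; rewrite i1.
    subst i j; case: m => _ /far_belowP far uw; constructor 1; split.
      move: far; rewrite (val_sopp w) /window /= => -[].
      by have /= [] := sintP (val w one); lia.
    move=> k; rewrite /window uw cswap_one.
    by case: eqVneq => // ->; rewrite (val_sopp w).
  have [i' ie] := sint_pos i_gt0; have [j' je] := sint_pos j_gt0.
  subst i j; case: m => _ far uw; constructor 2; exists i', j'; split=> //.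
    by move: ij => /adjacentP /=; lia.
  by move=> k; rewrite /window uw cswap_tperm.
subst i j; constructor 3; split; first exact: move_top_le m.
case: m => _ _ uw k; rewrite /window uw cswap_top.
by case: eqVneq => // ->; rewrite (val_sopp w).
Qed.

(** * The componentwise order on levels *)

Definition weak u w : bool :=
  [forall c : sint n, [forall d : sint n,
     ((c : int) < d) ==> (level u c d <= level w c d)]].

Lemma weakP u w :
  reflect (forall c d, (c : int) < d -> level u c d <= level w c d) (weak u w).
Proof.
by apply: (iffP forallP) => [h c d cd|h c];
  [have /forallP/(_ d)/implyP := h c; exact|apply/forallP => d; apply/implyP/h].
Qed.

Lemma weak_order : is_partial_order weak.
Proof.
split=> [w|u w /andP[/weakP uw /weakP wu]|w u v /weakP uw /weakP wv].
- exact/weakP.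
- by apply: level_inj => c d cd; apply/le_anti; rewrite uw ?wu.
- by apply/weakP => c d cd; apply: le_trans (uw _ _ cd) (wv _ _ cd).
Qed.

Lemma level_eq_move u v w i j : move_at u w i j -> weak u v -> weak v w ->
  level v (val w i) (val w j) = level u (val w i) (val w j) -> v = u.
Proof.
move=> m /weakP uv /weakP vw e; apply: level_inj => c d cd.
have := uv _ _ cd; have := vw _ _ cd.
case: (level_move m cd) => -[hc hd]; last lia.
  by rewrite (sint_inj hc) (sint_inj hd) e.
have -> : c = sopp (val w j) by apply: sint_inj.
have -> : d = sopp (val w i) by apply: sint_inj.
by rewrite !level_sopp e.
Qed.

Lemma level_move_wall u w i j : move_at u w i j ->
  level u (val w i) (val w j) = level w (val w i) (val w j) - 1.
Proof.
move=> m; have /far_belowP[ab _ _] : far_below (val w i) (val w j) by case: m.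
by have [[]|[]|[]] := level_move m ab => //; tauto.
Qed.

(** An intermediate v is squeezed at every level; at the one that drops by 1 it agrees with u or
    with w, and so coincides with it. *)
Lemma move_covered u w i j : move_at u w i j -> is_covered_by weak u w.
Proof.
move=> m; have /far_belowP[ab _ _] : far_below (val w i) (val w j) by case: m.
have wallE := level_move_wall m; split.
- by apply/weakP => c d cd; have [[]|[]|[]] := level_move m cd; lia.
- by move=> e; move: wallE; rewrite e; lia.
move=> v uv vw; have /weakP/(_ _ _ ab) := uv; have /weakP/(_ _ _ ab) := vw.
have [e|ne] := eqVneq (level v (val w i) (val w j)) (level u (val w i) (val w j)).
  by left; apply: level_eq_move m uv vw e.
move=> vw_ab uv_ab; right; apply: level_inj => c d cd.
have /weakP/(_ _ _ cd) := uv; have /weakP/(_ _ _ cd) := vw.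
case: (level_move m cd) => -[hc hd]; last lia.
  rewrite (sint_inj hc) (sint_inj hd); lia.
have -> : c = sopp (val w j) by apply: sint_inj.
have -> : d = sopp (val w i) by apply: sint_inj.
by rewrite !level_sopp; lia.
Qed.

(** The point is to stay in X_n: the value 1 changes the sign of its position only by exchanging
    places with -1, and neither order of these two satisfies the far-below condition. *)
Lemma exists_move_at w i j : wall n_gt0 i j -> far_below (val w i) (val w j) ->
  exists u, move_at u w i j.
Proof.
move=> ij far.
have inj : injective (fun k => val w (cswap i j k)).
  by move=> k l /perm_inj /(can_inj (cswapK i j)).
have sgn : signed_perm (perm inj).
  by apply/forallP => k; rewrite !permE cswap_sopp (val_sopp w).
have posi : 0 < (((perm inj)^-1)%g one : int).
  have -> : ((perm inj)^-1)%g one = cswap i j (((val w)^-1)%g one).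
    by apply: (@perm_inj _ (perm inj)); rewrite permKV permE cswapK permKV.
  have := pos_one_gt0 w; have := cswapP i j (((val w)^-1)%g one).
  have abs_i : ((val w)^-1)%g one = i -> (val w i : int) = 1.
    by move=> <-; rewrite permKV.
  have abs_j : ((val w)^-1)%g one = j -> (val w j : int) = 1.
    by move=> <-; rewrite permKV.
  move/far_belowP: far; rewrite /pos.
  move: (((val w)^-1)%g one) abs_i abs_j => p abs_i abs_j.
  have {}abs_i : (p : int) = i -> (val w i : int) = 1 by move/sint_inj.
  have {}abs_j : (p : int) = j -> (val w j : int) = 1 by move/sint_inj.
  lazy zeta; move: (cswap i j p : int) => q far.
  have opp : (j : int) = - (i : int) -> (val w j : int) = - (val w i : int).
    by move=> ji; have -> : j = sopp i by [apply: sint_inj]; rewrite (val_sopp w).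
  have [i0 _] := sintP i; have [j0 _] := sintP j.
  have {}ij : (j : int) = (i : int) + 1 \/ (j : int) = - (i : int).
    by case: ij => [/adjacentP|[-> ->]]; [lia|right].
  by case: far => f1 f2 f3; case=> [[] [? ?]|[? ? ? ? ?]] ?; case: ij => ?; lia.
have uX : signed_perm (perm inj) && (0 < (((perm inj)^-1)%g one : int)).
  by rewrite sgn posi.
pose X (s : {perm sint n}) := signed_perm s && (0 < ((s^-1)%g one : int)).
by exists (exist X _ uX); split=> // k; rewrite /= permE.
Qed.

(* The chosen point of the alcove of u, in the coordinates z for which the   *)
(* alcove of w is 0 < z_{w_1} < ... < z_{w_n} < 1/2, rescaled by 2n + 1.     *)
Definition relative_pos u w c : int :=
  lifted_pos u c - (n.*2.+1)%:Z * height w c.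

Lemma relative_pos_level_lt u w c d : c <> d ->
  (relative_pos u w d <= relative_pos u w c) =
  (level u c d < height w d - height w c).
Proof.
move=> cd; have := level_bounds u cd; rewrite /relative_pos.
move: (lifted_pos u c) (lifted_pos u d) (height w c) (height w d) => yc yd hc hd.
move: (level u c d) => l /andP[l1 l2]; apply/idP/idP => h; nia.
Qed.

Lemma relative_pos_inj u w : injective (relative_pos u w).
Proof.
move=> c d cd; apply/eqP/negP => /negP/eqP ncd.
have := relative_pos_level_lt u w ncd; rewrite cd lexx => /esym.
have := relative_pos_level_lt u w (nesym ncd); rewrite cd lexx => /esym.
have := level_bounds u ncd; have := level_bounds u (nesym ncd).
move: (lifted_pos u c) (lifted_pos u d) (height w c) (height w d) => yc yd hc hd.
by move: (level u c d) (level u d c) => l l' /andP[? ?] /andP[? ?] ? ?; nia.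
Qed.

(* Only walls on the far side from the fundamental alcove can separate u <= w *)
(* from w.                                                                    *)
Lemma weak_far_below u w i j : weak u w -> adjacent i j ->
  relative_pos u w (val w j) <= relative_pos u w (val w i) ->
  far_below (val w i) (val w j).
Proof.
move=> /weakP uw ij.
have ij_lt := adjacent_lt ij.
have nab : val w i <> val w j by move=> /perm_inj e; move: ij_lt; rewrite e ltxx.
move=> h; have := h; rewrite relative_pos_level_lt // => lev.
have [ab|ba|/sint_inj//] := ltrgtP (val w i : int) (val w j : int).
  (* Adjacent values have level 0 for both u and w. Position i precedes j, so their heights in w
     agree, against [lev]. *)
  apply: contraT => nfar.
  have adj : adjacent (val w i) (val w j) by rewrite /adjacent ab.
  move: lev; rewrite (level_adjacent u adj).
  by have := level_adjacent w adj; rewrite /level !pos_val; lia.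
(* If the values decrease, the correction in the level of w and u <= w give the opposite inequality,
   so two distinct values would share a relative position. *)
have := uw _ _ ba; rewrite {2}/level !pos_val ij_lt => lev'.
have : relative_pos u w (val w i) <= relative_pos u w (val w j).
  by rewrite relative_pos_level_lt; [lia|exact: nesym].
by move=> h'; case: nab; apply: (@relative_pos_inj u w); apply/le_anti/andP.
Qed.

Lemma relative_pos_sopp u w c : relative_pos u w (sopp c) = - relative_pos u w c.
Proof. by rewrite /relative_pos lifted_pos_sopp height_sopp; lia. Qed.

(** The hypothesis says that the point of u is on or beyond the wall z_{w_n} = 1/2. A positive w_n
    would give u a larger level than w from -w_n to w_n; w_n = -1 would put the value 1 at position
    -n. *)
Lemma weak_far_below_top u w : weak u w ->
  (n.*2.+1)%:Z <= 2 * relative_pos u w (val w top) ->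
  far_below (val w top) (sopp (val w top)).
Proof.
move=> /weakP uw h; apply/far_belowP => /=.
have wa : pos w (val w top) = n%:Z by rewrite pos_val topE.
have [a0 _] := sintP (val w top).
suff [h1 h2] : (val w top : int) < 0 /\ (val w top : int) <> -1.
  by move: h1 h2 a0 => /= *; split; lia.
split.
  rewrite ltNge; apply/negP => a_ge0.
  have aa : (sopp (val w top) : int) < val w top by move: a_ge0 a0 => /=; lia.
  have naa : sopp (val w top) <> val w top by move=> e; move: aa; rewrite e ltxx.
  have lw : level w (sopp (val w top)) (val w top) = 2 * height w (val w top).
    by rewrite /level height_sopp pos_sopp wa; lia.
  have := uw _ _ aa; have := level_bounds u naa; move: h.
  rewrite lw /relative_pos lifted_pos_sopp.
  by move: (level u _ _) (lifted_pos u _) (height w _) => l y hh; nia.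
move=> a1; have adj : adjacent (val w top) (sopp (val w top)).
  by apply/adjacentP => /=; move: a1 => /=; lia.
by have := adjacent_opp_pos w adj erefl; rewrite wa; lia.
Qed.

Lemma weak_move_at u w i j : weak u w -> wall n_gt0 i j ->
  far_below (val w i) (val w j) ->
  level u (val w i) (val w j) < level w (val w i) (val w j) ->
  exists2 v, move_at v w i j & weak u v.
Proof.
move=> /weakP uw ij far lev; have [v m] := exists_move_at ij far.
exists v => //; apply/weakP => c d cd.
have := uw _ _ cd; case: (level_move m cd) => -[hc hd ->]; last by [].
  by rewrite (sint_inj hc) (sint_inj hd); lia.
have -> : c = sopp (val w j) by apply: sint_inj.
have -> : d = sopp (val w i) by apply: sint_inj.
by rewrite !level_sopp; lia.
Qed.

(** The inequalities place the chosen point of u inside the alcove of w, so its floors are the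
    levels of both. *)
Lemma eq_of_relative_pos u w :
  (forall i j, adjacent i j ->
     relative_pos u w (val w i) < relative_pos u w (val w j)) ->
  2 * relative_pos u w (val w top) < (n.*2.+1)%:Z -> u = w.
Proof.
move=> /adjacent_homo mono topN.
have mono' c d : pos w c < pos w d -> relative_pos u w c < relative_pos u w d.
  by move=> /mono; rewrite !permKV.
have bound c : 2 * relative_pos u w c < (n.*2.+1)%:Z.
  have [->//|ct] := eqVneq c (val w top).
  have : pos w c <> pos w (val w top) by move=> /pos_inj; exact/eqP.
  have [_] := posP w c; rewrite pos_val topE => cn nc.
  have : pos w c < pos w (val w top) by rewrite pos_val topE; lia.
  by move=> /mono'; lia.
apply: level_inj => c d cd.
have ncd : c <> d by move=> e; move: cd; rewrite e ltxx.
have b1 := bound c; have b2 := bound d.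
have := bound (sopp c); have := bound (sopp d); rewrite !relative_pos_sopp => b3 b4.
have := level_bounds u ncd; have := mono' c d; have := mono' d c.
have := pos_eq w c d; move: b1 b2 b3 b4; rewrite /(level w c d) /relative_pos.
move: (lifted_pos u c) (lifted_pos u d) (height w c) (height w d) => yc yd hc hd.
move: (level u c d) => l b1 b2 b3 b4 pe.
have {pe} : pos w c <> pos w d by move=> /pe e; move: cd; rewrite e ltxx.
move=> ncd' dc_mono cd_mono /andP[? ?].
have [h|h|//] := ltrgtP (pos w c) (pos w d).
  by have := cd_mono h; nia.
by have := dc_mono h; nia.
Qed.

Lemma exists_move u w : weak u w -> u <> w ->
  exists2 v, (exists i j, move_at v w i j) & weak u v.
Proof.
move=> uw neq_uw.
have [/existsP[i /existsP[j /andP[ij viol]]]|noviol] := boolP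
    [exists i : sint n, [exists j : sint n, adjacent i j &&
      (relative_pos u w (val w j) <= relative_pos u w (val w i))]].
  have far := weak_far_below uw ij viol.
  have [||v m uv] := weak_move_at uw _ far _; last by exists v => //; exists i, j.
    by left.
  have ij_lt := adjacent_lt ij.
  have nab : val w i <> val w j by move=> /perm_inj e; move: ij_lt; rewrite e ltxx.
  by move: viol; rewrite relative_pos_level_lt // /(level w _ _) !pos_val; lia.
have [viol|topN] := lerP (n.*2.+1)%:Z (2 * relative_pos u w (val w top)).
  have far := weak_far_below_top uw viol.
  have [|||v m uv] := @weak_move_at u w top (sopp top) uw;
    last by exists v => //; exists top, (sopp top).
  - by right.
  - by rewrite (val_sopp w).
  have wa : pos w (val w top) = n%:Z by rewrite pos_val topE.
  have nab : val w top <> sopp (val w top).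
    by move=> /(congr1 (@sint_val n)) /=; have [] := sintP (val w top) => /=; lia.
  have lw : level w (val w top) (sopp (val w top)) = - 2 * height w (val w top) - 1.
    by rewrite /level height_sopp pos_sopp wa; lia.
  have := level_bounds u nab; move: viol.
  rewrite (val_sopp w) lw /relative_pos lifted_pos_sopp.
  by move: (level u _ _) (lifted_pos u _) (height w _) => l y hh; nia.
case: neq_uw; apply: eq_of_relative_pos => // i j ij; rewrite ltNge.
apply: contra noviol => h; apply/existsP; exists i; apply/existsP; exists j.
by rewrite ij.
Qed.

Lemma harpoon_covered u w : harpoon u w <-> is_covered_by weak u w.
Proof.
split=> [/harpoonP[i [j]]|[uw neq_uw cov]]; first exact: move_covered.
have [v [i [j m]] uv] := exists_move uw neq_uw.
have [vw neq_vw _] := move_covered m.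
by have [<-|//] := cov v uv vw; apply/harpoonP; exists i, j.
Qed.

End WeakOrder.

(** * Alcoves as cells *)

Section Geometry.
Variables (R : realType) (n : nat) (n_gt0 : (0 < n)%N).
Implicit Types (c d : sint n) (w : Xn n_gt0) (x y a : 'rV[R]_n).

Local Notation one := (spos (ofirst n_gt0)).
Local Notation top := (spos (olast n_gt0)).

(** * Roots as gaps of the odd extension *)

Definition ext x c : R :=
  let k := insubd (ofirst n_gt0) `|(c : int)|.-1 in
  if 0 < (c : int) then x 0 k else - x 0 k.

Lemma ext_spos x (k : 'I_n) : ext x (spos k) = x 0 k.
Proof.
rewrite /ext /=; congr (x 0 _).
by apply: val_inj; rewrite val_insubd /= ltn_ord.
Qed.

Lemma ext_sopp x c : ext x (sopp c) = - ext x c.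
Proof.
rewrite /ext /= abszN oppr_gt0; have [c0 _] := sintP c.
by case: ltrgtP => //; rewrite ?opprK.
Qed.

Definition gap x c d : R := ext x d - ext x c.

Lemma gap_sopp x c d : gap x (sopp d) (sopp c) = gap x c d.
Proof. by rewrite /gap !ext_sopp opprK addrC. Qed.

Lemma dot_stdb x (k : 'I_n) : dot x (stdb R k) = x 0 k.
Proof.
rewrite /dot /stdb (bigD1 k) //= big1 ?addr0 ?mxE ?eqxx ?mulr1 //.
by move=> l /negbTE lk; rewrite !mxE lk mulr0.
Qed.

Lemma dotD x a b : dot x (a + b) = dot x a + dot x b.
Proof. by rewrite /dot -big_split; apply: eq_bigr => k _; rewrite mxE mulrDr. Qed.

Lemma dotZ x (r : R) a : dot x (r *: a) = r * dot x a.
Proof. by rewrite /dot mulr_sumr; apply: eq_bigr => k _; rewrite mxE mulrCA. Qed.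

Lemma dotB x a b : dot x (a - b) = dot x a - dot x b.
Proof. by rewrite dotD -scaleN1r dotZ mulN1r. Qed.

Lemma root_gap a : pos_roots a ->
  exists2 cd : sint n * sint n, (cd.1 : int) < cd.2 &
    forall x, dot x a = gap x cd.1 cd.2.
Proof.
case=> [[i [j [ij [->|->]]]]|[i ->]].
- exists (sopp (spos i), spos j) => [|x] //=.
  by rewrite /gap ext_sopp !ext_spos dotD !dot_stdb opprK.
- exists (spos i, spos j) => [|x] /=; first by lia.
  by rewrite /gap !ext_spos dotB !dot_stdb.
- exists (sopp (spos i), spos i) => [|x] //=.
  by rewrite /gap ext_sopp !ext_spos dotZ !dot_stdb opprK mulr_natl mulr2n.
Qed.

Lemma gap_root c d : (c : int) < d ->
  exists2 a, pos_roots a & forall x, dot x a = gap x c d.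
Proof.
have [k [->|->]] := sint_spos c; have [l [->|->]] := sint_spos d => cd.
- exists (stdb R l - stdb R k) => [|x].
    by left; exists k, l; split; [move: cd => /=; lia|right].
  by rewrite /gap !ext_spos dotB !dot_stdb.
- by move: cd => /=; lia.
- have [kl|lk|/val_inj<-] := ltngtP k l.
  + exists (stdb R l + stdb R k) => [|x]; first by left; exists k, l; split=> //; left.
    by rewrite /gap ext_sopp !ext_spos dotD !dot_stdb opprK.
  + exists (stdb R k + stdb R l) => [|x]; first by left; exists l, k; split=> //; left.
    by rewrite /gap ext_sopp !ext_spos dotD !dot_stdb opprK addrC.
  + exists (2 *: stdb R k) => [|x]; first by right; exists k.
    by rewrite /gap ext_sopp !ext_spos dotZ !dot_stdb opprK mulr_natl mulr2n.
exists (stdb R k - stdb R l) => [|x].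
  by left; exists l, k; split; [move: cd => /=; lia|right].
by rewrite -[RHS]gap_sopp !soppK /gap !ext_spos dotB !dot_stdb.
Qed.

Lemma arrangement_complP x : arrangement_compl x <->
  forall c d (m : int), (c : int) < d -> gap x c d <> m%:~R.
Proof.
split=> [xC c d m cd e|h [a ra [m _]]].
  have [a ra ha] := gap_root cd.
  by apply: xC; exists a => //; exists m => //; rewrite /hyperplane /= ha.
by have [[c d] /= cd ha] := root_gap ra; rewrite /hyperplane /= ha; exact: h.
Qed.

(** * Open alcoves as connected components *)

Definition cell w : set 'rV[R]_n :=
  [set x | forall c d, (c : int) < d ->
     (level w c d)%:~R < gap x c d < (level w c d + 1)%:~R].

Lemma cell_arrangement w : cell w `<=` @arrangement_compl R n.
Proof.
move=> x xw; apply/arrangement_complP => c d m cd e.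
by have := xw _ _ cd; rewrite e !ltr_int; lia.
Qed.

Definition alcove_point w : 'rV[R]_n :=
  \row_k ((lifted_pos w (spos k))%:~R / (n.*2.+1)%:R).

Lemma ext_alcove_point w c : ext (alcove_point w) c = (lifted_pos w c)%:~R / (n.*2.+1)%:R.
Proof.
have [k [->|->]] := sint_spos c; rewrite ?ext_sopp ext_spos mxE //.
by rewrite lifted_pos_sopp rmorphN mulNr.
Qed.

Lemma alcove_point_cell w : cell w (alcove_point w).
Proof.
move=> c d cd; rewrite /gap !ext_alcove_point -mulrBl -rmorphB /=.
have N0 : 0 < (n.*2.+1)%:R :> R by rewrite ltr0n.
rewrite ltr_pdivlMr // ltr_pdivrMr //.
have -> : (n.*2.+1)%:R = (n.*2.+1)%:Z%:~R :> R by [].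
rewrite -!intrM !ltr_int ![_ * (n.*2.+1)%:Z]mulrC; apply: level_bounds => e.
by move: cd; rewrite e ltxx.
Qed.

Lemma gap_continuous c d : continuous (fun x => gap x c d).
Proof.
have ext_continuous e : continuous (fun x => ext x e).
  move=> x; rewrite /ext; case: (0 < (e : int)); first exact: coord_continuous.
  by apply: continuousN; exact: coord_continuous.
by move=> x; apply: continuousB; exact: ext_continuous.
Qed.

(** A gap maps a connected set to an interval, and off the arrangement that interval contains no
    integer. *)
Lemma component_sub_cell w x : cell w x ->
  connected_component (@arrangement_compl R n) x `<=` cell w.
Proof.
move=> xw y [B [Bx BC Bconn] By] c d cd.
have itv : is_interval ((fun z => gap z c d) @` B).
  apply/connected_intervalP/connected_continuous_connected => //.
  by apply: continuous_subspaceT; exact: gap_continuous.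
have noint (m : int) : ~ ((fun z => gap z c d) @` B) m%:~R.
  by move=> [z Bz e]; have /arrangement_complP/(_ _ _ m cd) := BC _ Bz.
have /andP[x1 x2] := xw _ _ cd.
have im z : B z -> ((fun z => gap z c d) @` B) (gap z c d) by exists z.
apply/andP; split; rewrite ltNge; apply/negP => h.
  apply: (noint (level w c d)).
  by apply: (itv _ _ (im _ By) (im _ Bx)); rewrite h ltW.
apply: (noint (level w c d + 1)).
by apply: (itv _ _ (im _ Bx) (im _ By)); rewrite h ltW.
Qed.

Lemma gap_line x y (t : R) c d :
  gap (x + t *: (y - x)) c d = (1 - t) * gap x c d + t * gap y c d.
Proof.
have ext_line e : ext (x + t *: (y - x)) e = (1 - t) * ext x e + t * ext y e.
  have [k [->|->]] := sint_spos e; rewrite ?ext_sopp !ext_spos !mxE; ring.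
rewrite /gap !ext_line; ring.
Qed.

(** The cell is convex, so the segment from x to y is a connected set avoiding all hyperplanes. *)
Lemma cell_component w x : cell w x ->
  connected_component (@arrangement_compl R n) x = cell w.
Proof.
move=> xw; apply/seteqP; split; first exact: component_sub_cell.
move=> y yw.
pose f (t : R) := x + t *: (y - x).
have fcont : continuous f.
  move=> t; apply: (cvgD (cvg_cst x)).
  exact: (@scalel_continuous _ _ (y - x) t).
exists (f @` `[0, 1]%classic); last first.
  by exists 1; rewrite /= ?in_itv /= ?ler01 ?lexx // /f scale1r addrC subrK.
split.
- by exists 0; rewrite /= ?in_itv /= ?ler01 ?lexx // /f scale0r addr0.
- move=> _ [t /= t01 <-]; apply: (@cell_arrangement w) => c d cd.
  rewrite gap_line; have /andP[x1 x2] := xw _ _ cd; have /andP[y1 y2] := yw _ _ cd.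
  move: t01; rewrite in_itv /= => /andP[t0 t1].
  by case: (lerP (gap x c d) (gap y c d)) => ?; apply/andP; split; nra.
- apply: connected_continuous_connected; first exact: segment_connected.
  exact: continuous_subspaceT.
Qed.

Definition alcove_of w : set 'rV[R]_n := closure (cell w).

Lemma alcove_of_bounds w x c d : alcove_of w x -> (c : int) < d ->
  (level w c d)%:~R <= gap x c d <= (level w c d + 1)%:~R.
Proof.
move=> xw cd.
pose I : set R := `[(level w c d)%:~R, (level w c d + 1)%:~R]%classic.
have cl : closed ((fun z => gap z c d) @^-1` I).
  apply: preimage_closed; last exact: itv_closed.
  by move=> z _; exact: gap_continuous.
have sub : cell w `<=` (fun z => gap z c d) @^-1` I.
  by move=> z /(_ _ _ cd)/andP[z1 z2]; rewrite /I /preimage /= in_itv /= !ltW.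
by have := closureS sub xw; rewrite -(proj1 (closure_id _) cl) /I /preimage /= in_itv.
Qed.

Lemma PiC_adjacent x : PiC n_gt0 x <->
  forall c d, adjacent c d -> 0 <= gap x c d <= 1.
Proof.
have two : 2 * x 0 (ofirst n_gt0) = gap x (sopp one) one.
  by rewrite /gap ext_sopp ext_spos opprK mulr_natl mulr2n.
split=> [[x1 xadj] c d cd|h].
  have pos_adj c' d' : adjacent c' d' -> 0 < (c' : int) -> 0 <= gap x c' d' <= 1.
    move=> /adjacentP cd' c'_gt0.
    have [|k ck] := @sint_pos n c'; first by [].
    have [|l dl] := @sint_pos n d'; first by lia.
    subst c' d'; rewrite /gap !ext_spos; apply: xadj.
    by move: cd' => /=; lia.
  have [c0 _] := sintP c; have [d0 _] := sintP d.
  case: (ltrP 0 (c : int)) => [|c_le0]; first exact: pos_adj.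
  case: (ltrP (d : int) 0) => [d_lt0|d_ge0].
    by rewrite -gap_sopp; apply: pos_adj; [exact: adjacent_sopp|rewrite /=; lia].
  have -> : c = sopp one by apply: sint_inj => /=; move: cd => /adjacentP; lia.
  have -> : d = one by apply: sint_inj => /=; move: cd => /adjacentP; lia.
  by rewrite -two.
split=> [|i j ij].
  by rewrite two; apply: h; apply/adjacentP => /=; lia.
by rewrite -!ext_spos; apply: h; apply/adjacentP => /=; lia.
Qed.

Lemma alcove_of_PiC w : alcove_of w `<=` PiC n_gt0.
Proof.
move=> x xw; apply/PiC_adjacent => c d cd.
by have := alcove_of_bounds xw (adjacent_lt cd); rewrite level_adjacent.
Qed.

Lemma alcove_of_hypersimplex w : let k := cdes ((val w)^-1)%g in
  alcove_of w `<=` hypersimplex R n_gt0 k.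
Proof.
move=> k x xw; split; first exact: alcove_of_PiC xw.
have tt : (sopp top : int) < top by [].
have := alcove_of_bounds xw tt.
have -> : level w (sopp top) top + 1 = k by rewrite -cdes_level.
have -> : level w (sopp top) top = k%:Z - 1.
  by rewrite /k cdes_level addrK.
by rewrite rmorphB /= /gap ext_sopp ext_spos opprK mulr_natl mulr2n.
Qed.

End Geometry.

(** * The bijection with alcoves of the polytope *)

Section AlcoveOrder.
Variables (R : realType) (n : nat) (n_gt0 : (0 < n)%N).
Implicit Types (c d : sint n) (u w : Xn n_gt0) (x y a : 'rV[R]_n).

Local Notation one := (spos (ofirst n_gt0)).
Local Notation gap := (gap n_gt0).
Local Notation ext := (ext n_gt0).

(* m is the nearest-integer function on coordinates, t the signed remainder.  *)
Lemma cell_exists x : arrangement_compl x -> PiC n_gt0 x ->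
  exists w : Xn n_gt0, cell w x.
Proof.
move=> /(arrangement_complP n_gt0) gen /PiC_adjacent adj.
pose m c := Num.floor (ext x c + 2^-1).
pose t c := ext x c - (m c)%:~R.
have nint c d (k : int) : c <> d -> gap x c d <> k%:~R.
  move=> cd; have [/gen//|dc e|/sint_inj//] := ltrgtP (c : int) d.
  by apply: (gen _ _ (- k) dc); rewrite rmorphN /= -e /gap opprB.
have ne_sopp c : sopp c <> c.
  by move=> /(congr1 (@sint_val n)) /=; have [] := sintP c; lia.
(* Equality on the left would make 2 x_c, the gap from -c to c, an odd integer. Strictness is what
   makes the rounding m odd. *)
have half c : (m c)%:~R < ext x c + 2^-1 < (m c + 1)%:~R.
  have /andP[h1 h2] := floor_itv (ext x c + 2^-1).
  rewrite h2 andbT lt_neqAle h1 andbT; apply/eqP => e.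
  apply: (nint (sopp c) c (2 * m c - 1)) => //.
  rewrite /gap ext_sopp rmorphB rmorphM /= /m e; lra.
have t_bound c : - 2^-1 < t c < 2^-1.
  have := half c; rewrite /t rmorphD /= => /andP[h1 h2].
  by apply/andP; split; lra.
have mN c : m (sopp c) = - m c.
  apply: floor_def; rewrite ext_sopp rmorphD /= !rmorphN /=.
  have := half c; rewrite rmorphD /= => /andP[h1 h2].
  by apply/andP; split; lra.
have tN c : t (sopp c) = - t c by rewrite /t ext_sopp mN rmorphN /= opprD opprK.
have gapE c d : gap x c d = (m d - m c)%:~R + (t d - t c).
  by rewrite /t /gap rmorphB /=; lra.
have t_inj : injective t.
  move=> c d tcd; have [//|/eqP cd] := eqVneq c d.
  by case: (nint c d (m d - m c) cd); rewrite gapE tcd subrr addr0.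
have [s sP] := perm_of_ltr t_inj.
(* As t is odd, conjugating s by negation preserves all comparisons. *)
have s_sopp c : s (sopp c) = sopp (s c).
  have inj : injective (fun c => sopp (s (sopp c))).
    by move=> e f /(can_inj (@soppK n))/perm_inj/(can_inj (@soppK n)).
  have sE : s = perm inj.
    by apply: perm_ltr_eq => e f; rewrite !permE /= ltrN2 !sP !tN ltrN2.
  by rewrite {1}sE permE soppK.
(* Here 0 < 2 x_1 < 1, so the first coordinate rounds to 0 and its remainder is positive. *)
have s_one : 0 < (s one : int).
  have adj1 : adjacent (sopp one) one by apply/adjacentP => /=; lia.
  have m1 : m one = 0.
    apply: floor_def; have := adj _ _ adj1.
    have := nint _ _ 1 (@ne_sopp one).
    rewrite /gap ext_sopp => /eqP ne1 /andP[h1 h2].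
    have lt1 : ext x one - - ext x one < 1 by rewrite lt_neqAle ne1.
    by apply/andP; split; lra.
  have t1 : t (sopp one) < t one.
    rewrite tN /t m1 subr0; have /andP[h1 _] := adj _ _ adj1.
    have := nint _ _ 0 (@ne_sopp one).
    move: h1; rewrite /gap ext_sopp => h1 /eqP ne0.
    have : 0 < ext x one - - ext x one by rewrite lt_neqAle eq_sym ne0.
    by lra.
  by move: t1; rewrite -sP s_sopp /=; lia.
have wX : signed_perm (s^-1)%g && (0 < (((s^-1)^-1)%g one : int)).
  rewrite monoid.invgK s_one andbT; apply/forallP => c; apply/eqP.
  by apply: (@perm_inj _ s); rewrite s_sopp !permKV.
pose X (v : {perm sint n}) := signed_perm v && (0 < ((v^-1)%g one : int)).
pose w : Xn n_gt0 := exist X (s^-1)%g wX.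
have posE c : pos w c = s c by rewrite /pos /= monoid.invgK.
have jump c d : c <> d -> (t d < t c) = ~~ (t c < t d).
  move=> cd; have : t c != t d by apply/eqP => /t_inj.
  by case: ltrgtP.
(* Remainders differ by less than 1 and adjacent gaps lie in (0, 1), so m jumps by 1 exactly where
   the remainder decreases and by 0 elsewhere. *)
have heightE : m =1 height w.
  apply: height_unique => // c d cd; rewrite !posE sP.
  have ncd : c <> d by move=> e; move: (adjacent_lt cd); rewrite e ltxx.
  have /andP[g0 g1] := adj _ _ cd.
  have {}g0 : 0 < gap x c d.
    by rewrite lt_neqAle g0 eq_sym andbT; exact/eqP/(nint _ _ 0).
  have {}g1 : gap x c d < 1.
    by rewrite lt_neqAle g1 andbT; exact/eqP/(nint _ _ 1).
  move: g0 g1; rewrite gapE; have /andP[c1 c2] := t_bound c.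
  have /andP[d1 d2] := t_bound d; move: (m d - m c) => k g0 g1.
  have [dc|cd'] := ltrP (t d) (t c).
    have : (0 : int)%:~R < k%:~R :> R by lra.
    have : k%:~R < (2 : int)%:~R :> R by lra.
    by rewrite !ltr_int /=; lia.
  have : (-1 : int)%:~R < k%:~R :> R by rewrite rmorphN /=; lra.
  have : k%:~R < (1 : int)%:~R :> R by lra.
  by rewrite !ltr_int /=; lia.
exists w => c d cd; have ncd : c <> d by move=> e; move: cd; rewrite e ltxx.
rewrite gapE /level !posE sP -!heightE.
have /andP[c1 c2] := t_bound c; have /andP[d1 d2] := t_bound d.
rewrite !rmorphD !rmorphN /=; move: (m d) (m c) => md mc.
have := jump _ _ ncd; case: (ltrgtP (t d) (t c)) => //= h _;
  by apply/andP; split; lra.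
Qed.

Lemma alcove_of_alcove w : alcove (@alcove_of R n n_gt0 w).
Proof.
exists (alcove_point R w); first exact/(@cell_arrangement _ _ _ w)/alcove_point_cell.
by rewrite (cell_component (alcove_point_cell R w)).
Qed.

Lemma alcove_of_alcove_point w : alcove_of w (alcove_point R w).
Proof. exact/subset_closure/alcove_point_cell. Qed.

Lemma fund_alcoveP x : fund_alcove x <->
  forall c d, (c : int) < d -> 0 <= gap x c d <= 1.
Proof.
split=> [xf c d cd|h a /(root_gap n_gt0)[[c d] /= cd ->]]; last exact: h.
by have [a ra <-] := gap_root R n_gt0 cd; exact: xf.
Qed.

Lemma fund_alcove_interior : exists2 x, @fund_alcove R n x &
  forall c d, (c : int) < d -> 0 < gap x c d.
Proof.
pose x : 'rV[R]_n := \row_k (k.+1%:R / (n.*2.+1)%:R).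
have N0 : 0 < (n.*2.+1)%:R :> R by rewrite ltr0n.
have extE c : ext x c = (c : int)%:~R / (n.*2.+1)%:R.
  have [k [->|->]] := sint_spos c; rewrite ?ext_sopp ext_spos mxE //=.
  by rewrite rmorphN mulNr.
have gapE c d : gap x c d = ((d : int) - (c : int))%:~R / (n.*2.+1)%:R.
  by rewrite /gap !extE -mulrBl -rmorphB.
exists x => [|c d cd]; last by rewrite gapE divr_gt0 // ltr0z subr_gt0.
apply/fund_alcoveP => c d cd; rewrite gapE; apply/andP; split.
  by apply: divr_ge0 (ltW N0); rewrite ler0z subr_ge0 ltW.
rewrite ler_pdivrMr // mul1r.
have -> : (n.*2.+1)%:R = (n.*2.+1)%:Z%:~R :> R by [].
by rewrite ler_int; have [_] := sintP c; have [_] := sintP d; lia.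
Qed.

(** The gap ranges over [0, 1] on the fundamental alcove and within [l, l + 1] on that of w, with l
    nonnegative. Interior points rule out the boundary values of m, and the origin rules out the
    reversed separation. *)
Lemma separates_level w a (m : int) c d : (c : int) < d ->
  (forall x, dot x a = gap x c d) ->
  separates a m (@fund_alcove R n) (alcove_of w) <-> 1 <= m <= level w c d.
Proof.
move=> cd aE; split.
  have /andP[c1 c2] := alcove_point_cell R w cd.
  case=> -[hf hw].
    have [x xf /(_ _ _ cd) x0] := fund_alcove_interior.
    have := hf _ xf; rewrite aE => xm.
    have : (0 : int)%:~R < m%:~R :> R by apply: lt_le_trans xm.
    have := hw _ (@alcove_of_alcove_point w); rewrite aE => mc.
    have := le_lt_trans mc c2; rewrite !ltr_int; lia.
  have f0 : @fund_alcove R n 0.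
    apply/fund_alcoveP => e f _.
    by rewrite /gap /ext !mxE oppr0 !if_same subrr lexx ler01.
  have := hf _ f0; rewrite aE /gap /ext !mxE oppr0 !if_same subrr => m0.
  have {}m0 : m <= 0 by rewrite -(ler_int R).
  have := hw _ (@alcove_of_alcove_point w); rewrite aE => mc.
  have := lt_le_trans c1 mc; rewrite ltr_int.
  by have := level_ge0 w cd; lia.
move=> /andP[m1 ml]; left; split=> x xA; rewrite aE.
  move/fund_alcoveP: xA => /(_ _ _ cd)/andP[_ h]; apply: le_trans h _.
  by have : (1 : int)%:~R <= m%:~R :> R by rewrite ler_int.
have /andP[h _] := alcove_of_bounds xA cd; apply: le_trans h.
by rewrite ler_int.
Qed.

Lemma weak_leP u w : weak u w <-> weak_le (@alcove_of R n n_gt0 u) (alcove_of w).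
Proof.
split=> [/weakP uw a m ra|uw].
  have [[c d] /= cd aE] := root_gap n_gt0 ra.
  by rewrite !(separates_level _ _ cd aE); have := uw _ _ cd; lia.
apply/weakP => c d cd; have [a ra aE] := gap_root R n_gt0 cd.
have [l1|l0] := lerP 1 (level u c d); last by have := level_ge0 w cd; lia.
have /(separates_level _ _ cd aE) :
    separates a (level u c d) (@fund_alcove R n) (alcove_of w).
  by apply: uw => //; apply/(separates_level _ _ cd aE); rewrite l1 lexx.
by case/andP.
Qed.

Lemma alcove_of_bij : set_bij [set: Xn n_gt0] (IC R n_gt0) (@alcove_of R n n_gt0).
Proof.
split=> [w _|u w _ _ uw|B [[x xC ->] BPi]].
- by split; [exact: alcove_of_alcove|exact: alcove_of_PiC].
- have [_ anti _] := @weak_order n n_gt0.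
  apply: anti; apply/andP; split; apply/weak_leP; rewrite uw; exact/weak_leP/weakP.
have [|w xw] := cell_exists xC.
  by apply: BPi; apply: subset_closure; exact: connected_component_refl.
by exists w => //; rewrite (cell_component xw).
Qed.

(** The number cdes - 1 is the floor of 2 x_n at the chosen point of the alcove, where 0 < 2 x_n <
    2n - 1. *)
Lemma cdes_bounds w : (1 <= cdes ((val w)^-1)%g <= n.*2.-1)%N.
Proof.
set top := spos (olast n_gt0).
have tt : (sopp top : int) < top by [].
have := cdes_level w; rewrite -/top.
have := level_ge0 w tt; have := lifted_pos_top w; rewrite -/top.
have ntt : sopp top <> top by move=> e; move: tt; rewrite e ltxx.
have := level_bounds w ntt; rewrite lifted_pos_sopp.
move: (cdes _) (level _ _ _) (lifted_pos _ _) => k l y /andP[h1 h2] h3 h4 h5.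
have : l < n.*2.-1%:Z by nia.
lia.
Qed.

End AlcoveOrder.

Theorem theorem5p5 (R : realType) (n : nat) (n_gt0 : (0 < n)%N) :
  exists le : rel (Xn n_gt0),
    [/\ is_partial_order le,
        (forall u w : Xn n_gt0, harpoon u w <-> is_covered_by le u w)
      & exists A : Xn n_gt0 -> set 'rV[R]_n,
          [/\ set_bij [set: Xn n_gt0] (IC R n_gt0) A,
              (forall u w : Xn n_gt0, le u w <-> weak_le (A u) (A w))
            & (forall w : Xn n_gt0,
                 let k := cdes ((val w)^-1)%g in
                 (1 <= k <= n.*2.-1)%N /\ A w `<=` hypersimplex R n_gt0 k)]].
Proof.
exists (@weak n n_gt0); split; [exact: weak_order|exact: harpoon_covered|].
exists (@alcove_of R n n_gt0); split; [exact: alcove_of_bij|exact: weak_leP|].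
by move=> w k; split; [exact: cdes_bounds|exact: alcove_of_hypersimplex].
Qed.
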